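(* Let $\mathcal{X}\subset\mathbb{R}^n$ be open and let $\Phi\in C^0(\mathcal{X},\mathbb{R}^n)$ be a map which has at least one component $\Phi_i\in C^0(\mathcal{X},\mathbb{R})$, $i\in\{1,\ldots,n\}$, which is a topological Morse function with a topologically critical point. Then, under Assumptions 1 and 2, the map $\Phi$ cannot be embedded in the basic neural ODE architecture $\mathrm{NODE}_{(1)}$, i.e. there is no vector field $f$ satisfying Assumptions 1 and 2 such that $\Phi(x)=h_x(T)$ for all $x\in\mathcal{X}$.
   Context: Fix $T>0$. A basic neural ODE is the initial value problem $\frac{dh}{dt}=f(h(t),t)$, $h(0)=x\in\mathcal{X}\subset\mathbb{R}^n$, with $f:\mathbb{R}^n\times[0,T]\to\mathbb{R}^n$ continuous. Its solution is denoted $h_x$, and $\mathrm{NODE}_{(1)}:\mathcal{X}\to\mathbb{R}^n$, $\mathrm{NODE}_{(1)}(x):=h_x(T)$. Assumption 1: the vector field $f$ is continuous and the solution of the initial value problem exists for all $t\in[0,T]$. Assumption 2: the vector field $f$ is continuous and the solution of the initial value problem is unique for all $t\in\mathcal{I}$, where $\mathcal{I}$ is the maximal time interval of existence; uniqueness is understood in the sense that solution curves do not cross (two solutions of the ODE that agree at some time agree at all times at which both exist). Let $\Psi\in C^0(\mathcal{X},\mathbb{R})$ with $\mathcal{X}\subset\mathbb{R}^n$ open. A point $q\in\mathcal{X}$ is topologically ordinary if there exist a neighborhood $\mathcal{V}$ of $0\in\mathbb{R}^n$ and a homeomorphism $\eta:\mathcal{V}\to\eta(\mathcal{V})$ (onto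 its image in $\mathcal{X}$) with $\eta(0)=q$ and $\Psi(\eta(v_1,\ldots,v_n))=\Psi(q)+v_n$ for all $(v_1,\ldots,v_n)\in\mathcal{V}$. A point $p\in\mathcal{X}$ that is not topologically ordinary is topologically critical. A topologically critical point $p$ has index $k$ if there exist a neighborhood $\mathcal{U}$ of $0\in\mathbb{R}^n$ and a homeomorphism $\mu:\mathcal{U}\to\mu(\mathcal{U})$ (onto its image in $\mathcal{X}$) with $\mu(0)=p$ and $\Psi(\mu(u_1,\ldots,u_n))=\Psi(p)-\sum_{j=1}^k u_j^2+\sum_{j=k+1}^n u_j^2$ for all $(u_1,\ldots,u_n)\in\mathcal{U}$. $\Psi$ is a topological Morse function if every topologically critical point of $\Psi$ has some index in $\{0,1,\ldots,n\}$. *)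

(* Defs.v *)
From HB Require Import structures.
From mathcomp Require Import all_boot all_order all_algebra.
From mathcomp Require Import all_classical all_reals all_analysis.
Set Implicit Arguments.
Unset Strict Implicit.
Unset Printing Implicit Defensive.
Import Order.TTheory GRing.Theory Num.Theory.
Import numFieldNormedType.Exports.
Local Open Scope classical_set_scope.
Local Open Scope ring_scope.

(* The space R^n is 'rV[R]_n; where the last coordinate v_n
   is needed, the dimension is written n.+1 (so that n >= 1) and v_n is
   v ord0 ord_max. *)

(* The derivative at t is the limit of difference quotients along I, hence
   one-sided at the end points of I. Only the values of h on I matter. *)
Definition ode_solution (R : realType) (n : nat)
    (f : 'rV[R]_n * R -> 'rV[R]_n) (I : set R) (h : R -> 'rV[R]_n) : Prop :=
  forall t, I t ->
    (s - t)^-1 *: (h s - h t) @[s --> within I t^'] --> f (h t, t).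

Definition ivp_solution (R : realType) (n : nat) (T : R)
    (f : 'rV[R]_n * R -> 'rV[R]_n) (x : 'rV[R]_n) (h : R -> 'rV[R]_n) : Prop :=
  ode_solution f `[0, T] h /\ h 0 = x.

(* f is a total function, but only its values on R^n x [0, T] are used. *)
Definition continuous_field (R : realType) (n : nat) (T : R)
    (f : 'rV[R]_n * R -> 'rV[R]_n) : Prop :=
  {within [set: 'rV[R]_n] `*` `[0, T], continuous f}.

Definition assumption1 (R : realType) (n : nat) (T : R) (X : set 'rV[R]_n)
    (f : 'rV[R]_n * R -> 'rV[R]_n) : Prop :=
  continuous_field T f /\ forall x, X x -> exists h, ivp_solution T f x h.

Definition assumption2 (R : realType) (n : nat) (T : R)
    (f : 'rV[R]_n * R -> 'rV[R]_n) : Prop :=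
  continuous_field T f /\
  forall (I J : set R) (h k : R -> 'rV[R]_n),
    is_interval I -> I `<=` `[0, T] -> ode_solution f I h ->
    is_interval J -> J `<=` `[0, T] -> ode_solution f J k ->
    forall t0, I t0 -> J t0 -> h t0 = k t0 ->
    forall t, I t -> J t -> h t = k t.

(* The solution h_x; a junk value if there is none. Outside [0, T] its values
   are arbitrary. *)
Definition node_solution (R : realType) (n : nat) (T : R)
    (f : 'rV[R]_n * R -> 'rV[R]_n) (x : 'rV[R]_n) : R -> 'rV[R]_n :=
  xget (cst x) [set h | ivp_solution T f x h].

Definition NODE1 (R : realType) (n : nat) (T : R)
    (f : 'rV[R]_n * R -> 'rV[R]_n) (x : 'rV[R]_n) : 'rV[R]_n :=
  node_solution T f x T.

Definition embedded_in_NODE1 (R : realType) (n : nat) (T : R)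
    (X : set 'rV[R]_n) (Phi : 'rV[R]_n -> 'rV[R]_n) : Prop :=
  exists f : 'rV[R]_n * R -> 'rV[R]_n,
    [/\ assumption1 T X f, assumption2 T f
      & forall x, X x -> Phi x = NODE1 T f x].

Definition homeo_onto_image (U W : topologicalType) (V : set U)
    (g : U -> W) : Prop :=
  {within V, continuous g} /\
  exists g' : W -> U,
    {within g @` V, continuous g'} /\ (forall v, V v -> g' (g v) = v).

Definition top_ordinary (R : realType) (n : nat) (X : set 'rV[R]_n.+1)
    (Psi : 'rV[R]_n.+1 -> R) (q : 'rV[R]_n.+1) : Prop :=
  exists (V : set 'rV[R]_n.+1) (eta : 'rV[R]_n.+1 -> 'rV[R]_n.+1),
    [/\ nbhs (0 : 'rV[R]_n.+1) V, homeo_onto_image V eta, eta @` V `<=` X,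
        eta 0 = q
      & forall v, V v -> Psi (eta v) = Psi q + v ord0 ord_max].

Definition top_critical (R : realType) (n : nat) (X : set 'rV[R]_n.+1)
    (Psi : 'rV[R]_n.+1 -> R) (p : 'rV[R]_n.+1) : Prop :=
  X p /\ ~ top_ordinary X Psi p.

(* Coordinates are numbered from 0: j < k here is j <= k in 1-based indexing. *)
Definition top_index (R : realType) (n : nat) (X : set 'rV[R]_n.+1)
    (Psi : 'rV[R]_n.+1 -> R) (p : 'rV[R]_n.+1) (k : nat) : Prop :=
  exists (U : set 'rV[R]_n.+1) (mu : 'rV[R]_n.+1 -> 'rV[R]_n.+1),
    [/\ nbhs (0 : 'rV[R]_n.+1) U, homeo_onto_image U mu, mu @` U `<=` X,
        mu 0 = p
      & forall u, U u -> Psi (mu u) =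
          Psi p - \sum_(j < n.+1 | (j < k)%N) u ord0 j ^+ 2
                + \sum_(j < n.+1 | (k <= j)%N) u ord0 j ^+ 2].

Definition top_morse (R : realType) (n : nat) (X : set 'rV[R]_n.+1)
    (Psi : 'rV[R]_n.+1 -> R) : Prop :=
  {within X, continuous Psi} /\
  forall p, top_critical X Psi p ->
    exists k : nat, (k <= n.+1)%N /\ top_index X Psi p k.

(* Main.v *)
Require Import Defs.
From HB Require Import structures.
From mathcomp Require Import all_boot all_order all_algebra.
From mathcomp Require Import all_classical all_reals all_analysis.
From mathcomp Require Import perm ring lra.
Set Implicit Arguments.
Unset Strict Implicit.
Unset Printing Implicit Defensive.
Import Order.TTheory GRing.Theory Num.Theory.
Import numFieldNormedType.Exports.
Local Open Scope classical_set_scope.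
Local Open Scope ring_scope.

(** An ODE whose solutions do not cross can be run backwards.  If Phi is the
    time-T map of such an ODE on X, then near every point p of X it has a
    continuous right inverse g defined on a whole ball around Phi p: send y to
    the value at time 0 of the solution that ends at y at time T.  So Phi is a
    homeomorphism from a neighbourhood of p onto a ball, and in the chart
    v |-> g (Phi p + v) every component of Phi is an affine coordinate.  After
    exchanging that coordinate with the last one, this says that every point
    of X is topologically ordinary for every component of Phi, so that no
    component can have a topologically critical point.

    The work lies in constructing g ([NODE1_local_section]): the field f is
    merely continuous, so nothing guarantees a priori that a solution ending
    near Phi p exists back to time 0, nor that it depends continuously on its
    end point.  Both facts are local around a given solution h, so f is first
    replaced by a bounded, uniformly continuous field F that agrees with f on
    a box containing h ([truncated_field]).  For F, solutions ending anywhere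
    exist ([backward_peano]), and those ending near h T stay near h
    ([approx_solution_stable]); staying in the box, they solve the ODE of f.

    Both facts come from one compactness argument
    ([approx_solutions_subconverge]).  The equation k' = F (k, t) is written
    as an estimate between the values of k at two times, with an explicit
    error given by a modulus of continuity of F ([approx_solution]).  Such an
    estimate survives pointwise limits, so a limit solution can be built at
    every time separately, along a fixed nonprincipal ultrafilter on nat.
    Applied to Euler approximations this yields existence; applied to a
    sequence of solutions violating stability it yields a limit solution
    through h T, which is h by uniqueness, a contradiction. *)

(** * Ultralimits and uniform continuity *)

(** Limits along such an ultrafilter play the role of convergent subsequences,
    with one choice serving for all sequences, and for all times, at once. *)
Lemma nat_ultrafilter : exists U : set_system nat, UltraFilter U /\ U --> \oo.
Proof.
have [U [UU oU]] := @ultraFilterLemma nat \oo _.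
by exists U.
Qed.

(** Since U decides every set of indices, any cluster point of u along U is
    already its limit. *)
Lemma compact_ultralimit (V : topologicalType) (U : set_system nat)
    (K : set V) (u : nat -> V) :
  UltraFilter U -> compact K -> (forall m, K (u m)) ->
  exists2 l, K l & u @ U --> l.
Proof.
move=> UU cK Ku.
have [l [Kl cl]] := cK (u @ U) _ (@filterE _ U _ _ Ku).
exists l => // B lB; rewrite nbhs_filterE /=.
have [//|UnB] := in_ultra_setVsetC (u @^-1` B) UU.
by have [y [nBy By]] := cl (~` B) B UnB lB; case: (nBy By).
Qed.

Lemma inv_succ_ultra_cvg0 (R : realType) (U : set_system nat) :
  U --> \oo -> (m.+1%:R^-1 : R) @[m --> U] --> (0 : R).
Proof.
move=> Uoo; apply: cvg_trans (@cvg_harmonic R).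
exact: cvg_app.
Qed.

Lemma cvg0_norm_le (R : realType) (V : normedModType R) (I : Type)
    (F : set_system I) (v : I -> V) (b : I -> R) :
  Filter F -> (forall m, `|v m| <= b m) -> b @ F --> (0 : R) ->
  v @ F --> (0 : V).
Proof.
move=> FF vb b0; apply/cvgrPdist_lt => e e0.
move/cvgrPdist_lt : b0 => /(_ e e0); apply: filterS => m.
rewrite !sub0r !normrN; apply: le_lt_trans.
exact: le_trans (vb m) (ler_norm _).
Qed.

(** Heine-Cantor: two sequences of points that get arbitrarily close have the
    same ultralimit in K, where the continuity of f forces their images
    together. *)
Lemma uniform_continuity_on_compact (R : realType) (V W : normedModType R)
    (K : set V) (f : V -> W) :
  compact K -> {within K, continuous f} ->
  forall e, 0 < e -> exists2 d, 0 < d &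
    forall x y, K x -> K y -> `|x - y| <= d -> `|f x - f y| <= e.
Proof.
move=> cK cf e e0; apply: contrapT => nd.
have /choice[p pP] : forall m, exists p : V * V, [/\ K p.1, K p.2,
    `|p.1 - p.2| <= m.+1%:R^-1 & e < `|f p.1 - f p.2|].
  move=> m; apply: contrapT => np; apply: nd; exists m.+1%:R^-1 => //.
  move=> x y Kx Ky xy; rewrite leNgt; apply/negP => efxy.
  by apply: np; exists (x, y).
have [U [UU Uoo]] := nat_ultrafilter.
have PU : ProperFilter U by exact: ultra_proper.
have [l Kl pl] : exists2 l, K l & (p m).1 @[m --> U] --> l.
  by apply: compact_ultralimit cK _ => m; have [] := pP m.
have dl : ((p m).1 - (p m).2) @[m --> U] --> (0 : V).
  apply: cvg0_norm_le (inv_succ_ultra_cvg0 Uoo).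
  by move=> m; have [] := pP m.
have p2l : (p m).2 @[m --> U] --> l.
  rewrite -[l]subr0 (_ : (fun m => (p m).2) =
    (fun m => (p m).1) - (fun m => (p m).1 - (p m).2)); first exact: cvgB.
  by apply/funext => m; rewrite fctE opprB addrC subrK.
have fcvg (q : nat -> V) : (forall m, K (q m)) -> q @ U --> l ->
    f (q m) @[m --> U] --> f l.
  move=> Kq ql.
  apply: (@cvg_comp _ _ _ q f U (within K (nbhs l))).
    move=> B /= lB; rewrite nbhs_filterE /=.
    have := ql _ lB; rewrite nbhs_filterE /=.
    by apply: filterS => m /=; apply.
  by move/subspace_continuousP : cf; apply.
have c1 : f (p m).1 @[m --> U] --> f l.
  by apply: (fcvg (fun m => (p m).1)) => // m; have [] := pP m.
have c2 : f (p m).2 @[m --> U] --> f l.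
  by apply: (fcvg (fun m => (p m).2)) => // m; have [] := pP m.
have c0 : `|f (p m).1 - f (p m).2| @[m --> U] --> (0 : R).
  by rewrite -[X in _ --> X](normr0 W) -[X in `|X|](subrr (f l));
    apply: cvg_norm; exact: cvgB c1 c2.
have : e <= 0.
  apply: ler_cvg_to (cvg_cst e) c0 _.
  by apply: nearW => m; apply/ltW; have [] := pP m.
by rewrite leNgt e0.
Qed.

(** * Projection onto a box *)

Definition clamp (R : realDomainType) (a b x : R) := Num.max a (Num.min b x).

Lemma clamp_itv (R : realDomainType) (a b x : R) :
  a <= b -> a <= clamp a b x <= b.
Proof.
move=> ab; rewrite /clamp.
by case: (leP b x) => ?; [case: (leP a b)|case: (leP a x)] => ?; lra.
Qed.

Lemma clamp_id (R : realDomainType) (a b x : R) :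
  a <= x <= b -> clamp a b x = x.
Proof.
move=> /andP[ax xb]; rewrite /clamp.
by case: (leP b x) => ?; [case: (leP a b)|case: (leP a x)] => ?; lra.
Qed.

Lemma clamp_lipschitz (R : realDomainType) (a b x y : R) :
  a <= b -> `|clamp a b x - clamp a b y| <= `|x - y|.
Proof.
move=> ab; wlog xy : x y / x <= y.
  by move=> wl; case: (leP x y) => [|/ltW] /wl//; rewrite distrC (distrC y).
rewrite distrC (distrC x) (ger0_norm (_ : 0 <= y - x)) ?subr_ge0// ler_norml /clamp.
case: (leP b x) => bx; rewrite ?(max_r ab).
  by rewrite (min_l (le_trans bx xy)) (max_r ab); lra.
by case: (leP a x) => ?; case: (leP b y) => ?; rewrite ?(max_r ab); try lra;
  case: (leP a y) => ?; lra.
Qed.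

Lemma rV_norm_le (R : realType) (n : nat) (v : 'rV[R]_n) (c : R) : 0 <= c ->
  reflect (forall j, `|v ord0 j| <= c) (`|v| <= c).
Proof.
move=> c0; rewrite [X in X <= _]/Num.Def.normr /= mx_normrE.
apply: (iffP idP) => [/bigmax_leP[_ vc] j|vc].
  exact: (vc (ord0, j)).
by apply/bigmax_leP; split => // -[i j] _ /=; rewrite (ord1 i).
Qed.

Lemma rV_coord_le (R : realType) (n : nat) (v : 'rV[R]_n) j : `|v ord0 j| <= `|v|.
Proof. by have /rV_norm_le := lexx `|v|; apply. Qed.

Definition clamp_rV (R : realType) (n : nat) (B : R) (x : 'rV[R]_n) : 'rV[R]_n :=
  \row_j clamp (- B) B (x ord0 j).

Lemma clamp_rV_norm_le (R : realType) n (B : R) (x : 'rV[R]_n) :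
  0 <= B -> `|clamp_rV B x| <= B.
Proof.
move=> B0; apply/rV_norm_le => // j; rewrite mxE ler_norml.
by apply: clamp_itv; lra.
Qed.

Lemma clamp_rV_id (R : realType) n (B : R) (x : 'rV[R]_n) :
  `|x| <= B -> clamp_rV B x = x.
Proof.
move=> xB; apply/rowP => j; rewrite mxE clamp_id// -ler_norml.
exact: le_trans (rV_coord_le _ _) xB.
Qed.

Lemma clamp_rV_lipschitz (R : realType) n (B : R) (x y : 'rV[R]_n) :
  0 <= B -> `|clamp_rV B x - clamp_rV B y| <= `|x - y|.
Proof.
move=> B0; apply/rV_norm_le => // j; rewrite !mxE.
have := rV_coord_le (x - y) j; rewrite !mxE; apply: le_trans.
by apply: clamp_lipschitz; lra.
Qed.

(** * Approximate solutions and Euler polygons *)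

Definition modulus (R : realType) (V : normedModType R) (F : V * R -> V) (e d : R) :=
  forall x y s t, `|x - y| <= d -> `|s - t| <= d -> `|F (x, s) - F (y, t)| <= e.

Definition unif_modulus (R : realType) (V : normedModType R) (F : V * R -> V) :=
  forall e, 0 < e -> exists2 d, 0 < d & modulus F e d.

(** For a = 0 this says that k is M-Lipschitz and solves k' = F (k, t) on
    [0, T], the remainder of the first-order expansion being controlled by any
    modulus of continuity of F: along k, both arguments of F move by at most
    M * |s - t| (as M >= 1), hence F moves by at most e.  Every clause is a
    weak inequality between values of k at two times, which is what makes the
    notion stable under pointwise limits.  For a > 0 it is what Euler step
    functions of step a satisfy. *)
Definition approx_solution (R : realType) (V : normedModType R)
    (F : V * R -> V) (T M a : R) (k : R -> V) :=
  forall s t, 0 <= s <= T -> 0 <= t <= T ->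
    `|k s - k t| <= M * (`|s - t| + a) /\
    forall e d, 0 <= e -> modulus F e d -> M * (`|s - t| + a) < d ->
      `|k s - k t - (s - t) *: F (k t, t)| <= e * `|s - t| + (e + M) * a.

Fixpoint euler (R : realType) (V : normedModType R) (F : V * R -> V)
    (y : V) (a : R) (j : nat) : V :=
  if j is i.+1 then euler F y a i + a *: F (euler F y a i, i%:R * a) else y.

(** A step function instead of the usual polygon: its jumps have size O(a),
    which the error terms of [approx_solution] absorb. *)
Definition euler_curve (R : realType) (V : normedModType R) (F : V * R -> V)
    (y : V) (a t : R) : V := euler F y a (Num.truncn (t / a)).

(** The increment is the sum of the p steps a * F, each within a * e of a * v.
    With v = 0 this is a Lipschitz bound, with v the slope at a point it is a
    first-order expansion. *)
Lemma euler_increment (R : realType) (V : normedModType R) (F : V * R -> V)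
    (y v : V) (a e : R) (i p : nat) : 0 <= a ->
  (forall l, (i <= l < i + p)%N -> `|F (euler F y a l, l%:R * a) - v| <= e) ->
  `|euler F y a (i + p) - euler F y a i - (p%:R * a) *: v| <= e * (p%:R * a).
Proof.
move=> a0; elim: p => [|p IH] Fv.
  by rewrite addn0 subrr mul0r scale0r subr0 normr0 mulr0.
have {}IH : `|euler F y a (i + p) - euler F y a i - (p%:R * a) *: v| <= e * (p%:R * a).
  by apply: IH => l /andP[il lp]; apply: Fv; rewrite il addnS ltnW.
rewrite addnS /= -natr1 (mulrDl _ 1) mul1r scalerDl mulrDr.
rewrite (_ : _ - _ - _ = (euler F y a (i + p) - euler F y a i - (p%:R * a) *: v)
   + a *: (F (euler F y a (i + p), (i + p)%:R * a) - v)); last first.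
  rewrite scalerBr opprD !addrA; congr (_ - _).
  by rewrite -!addrA; congr (_ + _); rewrite addrC -!addrA.
apply: le_trans (ler_normD _ _) _; apply: lerD => //.
rewrite normrZ ger0_norm// mulrC ler_wpM2r//; apply: Fv.
by rewrite leq_addr addnS ltnS leqnn.
Qed.

(** Times s < t and s > t have to be treated alike in [approx_solution], so the
    increment is restated for indices in either order. *)
Lemma euler_difference (R : realType) (V : normedModType R) (F : V * R -> V)
    (y v : V) (a e : R) (i j : nat) : 0 <= a ->
  (forall l, (minn i j <= l < maxn i j)%N ->
     `|F (euler F y a l, l%:R * a) - v| <= e) ->
  `|euler F y a j - euler F y a i - (j%:R * a - i%:R * a) *: v|
    <= e * `|j%:R * a - i%:R * a|.
Proof.
wlog ij : i j / (i <= j)%N.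
  move=> wl a0 H; have [/wl|/ltnW /wl] := leqP i j; first exact.
  rewrite minnC maxnC => /(_ a0 H); rewrite (distrC (i%:R * a)); apply: le_trans.
  by rewrite -[leRHS]normrN !opprB addrC -scaleNr opprB.
move=> a0; rewrite (minn_idPl ij) (maxn_idPr ij) => H.
rewrite -mulrBl -natrB// ger0_norm ?mulr_ge0// -[in euler F y a j](subnKC ij).
by apply: euler_increment => // l; rewrite subnKC//; exact: H.
Qed.

(** The grid times below s and t differ from s and t by less than a, so
    between them the Euler points and the grid times stay within M * (|s-t| + a)
    of the point and the time t, and the slopes within e of F at time t. *)
Lemma euler_curve_approx (R : realType) (V : normedModType R) (F : V * R -> V)
    (T M a : R) (y : V) :
  0 < a -> 1 <= M -> (forall p, `|F p| <= M) ->
  approx_solution F T M a (euler_curve F y a).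
Proof.
move=> a0 M1 FM s t /andP[s0 _] /andP[t0 _]; rewrite /euler_curve.
set i := Num.truncn (t / a); set j := Num.truncn (s / a).
have /andP[] : i%:R <= t / a < i.+1%:R by apply: truncn_itv; rewrite divr_ge0// ltW.
rewrite ler_pdivlMr// ltr_pdivrMr// -natr1 mulrDl mul1r => ti it.
have /andP[] : j%:R <= s / a < j.+1%:R by apply: truncn_itv; rewrite divr_ge0// ltW.
rewrite ler_pdivlMr// ltr_pdivrMr// -natr1 mulrDl mul1r => sj js.
have lip l m : `|euler F y a l - euler F y a m| <= M * `|l%:R * a - m%:R * a|.
  have := @euler_difference R V F y 0 a M m l (ltW a0).
  by rewrite scaler0 subr0; apply => l' _; rewrite subr0.
have ij : `|j%:R * a - i%:R * a| <= `|s - t| + a.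
  by rewrite ler_norml; case: (ler0P (s - t)) => ?; lra.
have between l : (minn i j <= l < maxn i j)%N ->
    `|l%:R * a - i%:R * a| <= `|s - t| + a /\ `|l%:R * a - t| <= `|s - t| + a.
  move=> /andP[]; rewrite geq_min leq_max => ijl lij.
  have : i%:R * a <= l%:R * a \/ j%:R * a <= l%:R * a.
    by case/orP: ijl => ?; [left|right]; rewrite ler_pM2r// ler_nat.
  have : l%:R * a + a <= i%:R * a \/ l%:R * a + a <= j%:R * a.
    by rewrite -[X in _ + X]mul1r -mulrDl natr1; case/orP: lij => ?; [left|right];
      rewrite ler_pM2r// ler_nat.
  by rewrite !ler_norml; case: (ler0P (s - t)) => ? [?|?] [?|?]; split; lra.
split.
  by apply: le_trans (lip j i) _; rewrite ler_wpM2l//; lra.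
move=> e d e0 Fed std.
set v := F (_, t).
have std' : `|s - t| + a < d.
  by apply: le_lt_trans std; rewrite ler_peMl// addr_ge0// ltW.
rewrite (_ : _ - _ - _ = (euler F y a j - euler F y a i - (j%:R * a - i%:R * a) *: v)
   + (j%:R * a - i%:R * a - (s - t)) *: v); last by rewrite [X in _ = _ + X]scalerBl addrA subrK.
apply: le_trans (ler_normD _ _) _.
have -> : e * `|s - t| + (e + M) * a = e * (`|s - t| + a) + a * M by ring.
apply: lerD.
  apply: le_trans (_ : e * `|j%:R * a - i%:R * a| <= _); last by rewrite ler_wpM2l.
  apply: euler_difference => [|l /between[li lt]]; first exact: ltW.
  apply: Fed; last by apply: le_trans lt _; exact: ltW.
  apply: le_trans (lip _ _) _; apply: le_trans (ltW std).
  by rewrite ler_wpM2l//; lra.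
by rewrite normrZ; apply: ler_pM => //; [rewrite ler_norml; lra|exact: FM].
Qed.

(** The strict inequality M * (|s-t| + a) < d in [approx_solution] is used here:
    if it holds for the limit value of a, it holds eventually. *)
Lemma approx_solution_limit (R : realType) (V : normedModType R) (F : V * R -> V)
    (T M : R) (U : set_system nat) (a : nat -> R) (k : nat -> R -> V) (l : R -> V) :
  ProperFilter U -> unif_modulus F -> a @ U --> (0 : R) ->
  (forall m, approx_solution F T M (a m) (k m)) ->
  (forall t, 0 <= t <= T -> k m t @[m --> U] --> l t) ->
  approx_solution F T M 0 l.
Proof.
move=> PU uF a0 ak kl s t sT tT.
have M_a : M * (`|s - t| + a m) @[m --> U] --> M * (`|s - t| + 0).
  by apply: cvgMr; apply: cvgD => //; exact: cvg_cst.
split.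
  have c : `|k m s - k m t| @[m --> U] --> `|l s - l t|.
    by apply: cvg_norm; apply: cvgB; exact: kl.
  apply: ler_cvg_to c M_a _; apply: nearW => m.
  by have [] := ak m s t sT tT.
move=> e d e0 Fed std.
have cF : F (k m t, t) @[m --> U] --> F (l t, t).
  apply/cvgrPdist_le => eps eps0; have [r r0 Fr] := uF _ eps0.
  move/cvgrPdist_le : (kl t tT) => /(_ _ r0); apply: filterS => m klm.
  by apply: Fr; rewrite // subrr normr0 ltW.
have c : `|k m s - k m t - (s - t) *: F (k m t, t)| @[m --> U]
    --> `|l s - l t - (s - t) *: F (l t, t)|.
  apply: cvg_norm; apply: cvgB; first by apply: cvgB; exact: kl.
  by apply: cvgZr.
have c' : e * `|s - t| + (e + M) * a m @[m --> U] --> e * `|s - t| + (e + M) * 0.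
  by apply: cvgD; [exact: cvg_cst|apply: cvgMr].
apply: ler_cvg_to c c' _.
move/cvgr_lt : M_a => /(_ _ std); apply: filterS => m ad.
by have [_ /(_ e d e0 Fed)] := ak m s t sT tT; apply.
Qed.

(** The Lipschitz part of [approx_solution] keeps k m t in a fixed closed ball,
    which is compact, so each time t has its own ultralimit. *)
Lemma approx_solutions_subconverge (R : realType) (n : nat)
    (F : 'rV[R]_n * R -> 'rV[R]_n) (T M C : R) (a : nat -> R)
    (k : nat -> R -> 'rV[R]_n) (U : set_system nat) :
  UltraFilter U -> 0 <= M -> unif_modulus F ->
  (forall m, a m <= 1) -> a @ U --> (0 : R) ->
  (forall m, approx_solution F T M (a m) (k m)) ->
  (forall m, `|k m 0| <= C) ->
  exists l, approx_solution F T M 0 l /\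
    forall t, 0 <= t <= T -> k m t @[m --> U] --> l t.
Proof.
move=> UU M0 uF a1 a0 ak kC.
have PU : ProperFilter U by exact: ultra_proper.
have /choice[l kl] : forall t : R, exists l : 'rV[R]_n,
    0 <= t <= T -> k m t @[m --> U] --> l.
  move=> t; have [tT|] := boolP (0 <= t <= T); last by exists 0.
  have [||l _ kl] := @compact_ultralimit _ U
      (closed_ball_ (fun x => `|x|) 0 (C + M * (T + 1))) (fun m => k m t) UU; last by exists l.
  - apply: bounded_closed_compact.
      exists (C + M * (T + 1)); split; first exact: num_real.
      by move=> x xC y; rewrite /closed_ball_/= sub0r normrN => /le_trans; apply; exact: ltW.
    exact: closed_closed_ball_.
  - move=> m; rewrite /closed_ball_/= sub0r normrN.
    have /andP[t0 tT'] := tT.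
    have zT : 0 <= (0 : R) <= T by rewrite lexx (le_trans t0).
    have [+ _] := ak m t 0 tT zT; rewrite subr0 (ger0_norm t0) => km.
    rewrite -(subrK (k m 0) (k m t)) addrC; apply: le_trans (ler_normD _ _) _.
    by apply: lerD => //; apply: le_trans km _; rewrite ler_wpM2l// lerD.
by exists l; split => //; apply: (@approx_solution_limit _ _ _ _ _ U a k).
Qed.

(** * Existence for bounded, uniformly continuous fields *)

Lemma peano (R : realType) (n : nat) (F : 'rV[R]_n * R -> 'rV[R]_n) (T M : R)
    (y : 'rV[R]_n) :
  0 <= T -> 1 <= M -> (forall p, `|F p| <= M) -> unif_modulus F ->
  exists k, approx_solution F T M 0 k /\ k 0 = y.
Proof.
move=> T0 M1 FM uF.
have [U [UU Uoo]] := nat_ultrafilter.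
have PU : ProperFilter U by exact: ultra_proper.
pose a m : R := m.+1%:R^-1.
have k0 m : euler_curve F y (a m) 0 = y by rewrite /euler_curve mul0r truncn0.
have [|||m|m|l [lF kl]] := @approx_solutions_subconverge R n F T M `|y| a
  (fun m => euler_curve F y (a m)) U UU _ uF.
- by rewrite (le_trans ler01).
- by move=> m; rewrite invf_le1// ler1n.
- exact: inv_succ_ultra_cvg0.
- by apply: euler_curve_approx => //; rewrite invr_gt0.
- by rewrite k0.
exists l; split => //.
have l0 : euler_curve F y (a m) 0 @[m --> U] --> l 0 by apply: kl; rewrite lexx.
have ly : euler_curve F y (a m) 0 @[m --> U] --> y.
  by under eq_cvg do rewrite k0; exact: cvg_cst.
exact: (cvg_unique _ l0 ly).
Qed.

Lemma approx_solution_reversal (R : realType) (V : normedModType R)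
    (F : V * R -> V) (T M a : R) (k : R -> V) :
  approx_solution (fun p => - F (p.1, T - p.2)) T M a k ->
  approx_solution F T M a (fun t => k (T - t)).
Proof.
move=> kG s t /andP[s0 sT] /andP[t0 tT].
have dist u v : `|T - u - (T - v)| = `|u - v|.
  by rewrite distrC; congr `|_|; ring.
have [||lip der] := kG (T - s) (T - t); [lra|lra|].
rewrite dist in lip der; split => // e d e0 Fed std.
have := der e d e0 _ std; rewrite /= subKr scalerN opprK -scaleNr.
rewrite (_ : T - s - (T - t) = - (s - t)) ?scaleNr; last by ring.
by apply => x x' u u' xx uu /=; rewrite -opprD normrN; apply: Fed; rewrite // dist.
Qed.

(** Existence with a prescribed end point, by reversing time. *)
Lemma backward_peano (R : realType) (n : nat) (F : 'rV[R]_n * R -> 'rV[R]_n)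
    (T M : R) (y : 'rV[R]_n) :
  0 <= T -> 1 <= M -> (forall p, `|F p| <= M) -> unif_modulus F ->
  exists k, approx_solution F T M 0 k /\ k T = y.
Proof.
move=> T0 M1 FM uF.
have [||k [kG k0]] := @peano R n (fun p => - F (p.1, T - p.2)) T M y T0 M1.
- by move=> p; rewrite normrN.
- move=> e e0; have [d d0 Fd] := uF e e0; exists d => // x x' u u' xx uu /=.
  rewrite -opprD normrN; apply: Fd => //.
  by rewrite distrC (_ : _ - _ = u - u')//; ring.
exists (fun t => k (T - t)); split; first exact: approx_solution_reversal.
by rewrite subrr.
Qed.

Lemma approx_solution_ode (R : realType) (n : nat) (F f : 'rV[R]_n * R -> 'rV[R]_n)
    (T M : R) (I : set R) (k : R -> 'rV[R]_n) :
  0 < M -> unif_modulus F -> approx_solution F T M 0 k -> I `<=` `[0, T] ->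
  (forall t, I t -> F (k t, t) = f (k t, t)) ->
  ode_solution f I k.
Proof.
move=> M0 uF kF IT Ff t It; rewrite -Ff//.
apply/cvgrPdist_le => e e0; have [d d0 Fd] := uF e e0.
apply/nbhs_ballP; exists (d / M) => /=; first by rewrite divr_gt0.
move=> s; rewrite -ball_normE /= => std st Is.
have [_ /(_ e d (ltW e0) Fd)] := kF s t (IT _ Is) (IT _ It).
rewrite mulr0 !addr0 distrC mulrC -ltr_pdivlMr// => /(_ std) H.
have st0 : s - t != 0 by rewrite subr_eq0.
have := H; rewrite -(ler_pM2l (_ : 0 < `|(s - t)^-1|)) ?normr_gt0 ?invr_eq0//.
rewrite -normrZ mulrCA normfV (distrC t) mulVf ?normr_eq0// mulr1.
by rewrite scalerBr scalerA mulVf// scale1r distrC.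
Qed.

(** * Reduction to bounded fields *)

Lemma ode_solution_within_continuous (R : realType) (n : nat)
    (f : 'rV[R]_n * R -> 'rV[R]_n) (I : set R) (h : R -> 'rV[R]_n) :
  ode_solution f I h -> {within I, continuous h}.
Proof.
move=> hf; apply/subspace_continuousP => t It.
have /cvgrPdist_le/(_ 1 ltr01) := hf t It.
move=> /nbhs_ballP[r /= r0 hr].
set C := 1 + `|f (h t, t)|.
have C0 : 0 < C by rewrite ltr_pwDl.
apply/cvgrPdist_le => e e0; apply/nbhs_ballP.
exists (Num.min r (e / C)) => /=; first by rewrite lt_min r0 divr_gt0.
move=> s; rewrite -ball_normE /= lt_min => /andP[str ste] Is.
have [->|st] := eqVneq s t; first by rewrite subrr normr0 ltW.
have := hr s; rewrite -ball_normE /= => /(_ str st Is) H.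
have : `|(s - t)^-1 *: (h s - h t)| <= C.
  rewrite -(subrK (f (h t, t)) (_ *: _)); apply: le_trans (ler_normD _ _) _.
  by rewrite lerD2r distrC.
have st0 : 0 < `|s - t| by rewrite normr_gt0 subr_eq0.
rewrite normrZ normfV mulrC ler_pdivrMr// distrC => /le_trans; apply.
by rewrite mulrC -ler_pdivlMr// distrC ltW.
Qed.

(** Precomposing f with the projection onto a compact box changes nothing in
    the box, and makes f bounded and uniformly continuous because the
    projection is 1-Lipschitz. *)
Lemma truncated_field (R : realType) (n : nat) (f : 'rV[R]_n * R -> 'rV[R]_n)
    (T B : R) : 0 <= T -> 0 <= B -> continuous_field T f ->
  exists (F : 'rV[R]_n * R -> 'rV[R]_n) (M : R),
    [/\ 1 <= M, forall p, `|F p| <= M, unif_modulus F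
      & forall x t, `|x| <= B -> 0 <= t <= T -> F (x, t) = f (x, t)].
Proof.
move=> T0 B0 cf.
pose K : set ('rV[R]_n * R^o) := [set x | `|x| <= B] `*` `[0, T].
have cK : compact K.
  apply: compact_setX; last exact: segment_compact.
  apply: bounded_closed_compact.
    exists B; split; first exact: num_real.
    by move=> x xB y /= /le_trans; apply; exact: ltW.
  have := @closed_closed_ball_ R 'rV[R]_n 0 B; congr closed.
  by apply/seteqP; split => y; rewrite /closed_ball_/= sub0r normrN.
have cfK : {within K, continuous (f : 'rV[R]_n * R^o -> 'rV[R]_n)}.
  by apply: continuous_subspaceW cf => -[x t] [_ tT].
have uf := uniform_continuity_on_compact cK cfK.
have [M [_ fM]] := compact_bounded (continuous_compact cfK cK).
pose P (p : 'rV[R]_n * R) : 'rV[R]_n * R^o := (clamp_rV B p.1, clamp 0 T p.2).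
have PK p : K (P p).
  by split; [exact: clamp_rV_norm_le|rewrite /= in_itv; exact: clamp_itv].
pose M' := Num.max 1 (M + 1).
exists (f \o P), M'; split.
- by rewrite le_max lexx.
- move=> p; apply: (fM M'); first by rewrite lt_max (ltrDl M) ltr01 orbT.
  by exists (P p).
- move=> e e0; have [d d0 fd] := uf e e0; exists d => // x y s t xy st.
  apply: fd => //; rewrite [X in X <= _]/Num.Def.normr /= ge_max.
  rewrite (le_trans (clamp_rV_lipschitz _ _ B0))//=.
  exact: le_trans (clamp_lipschitz _ _ T0) st.
- by move=> x t xB tT; rewrite /P /= clamp_rV_id// clamp_id.
Qed.

(** * Uniqueness and stability *)

(** Uniqueness is known for f only, and k solves the ODE of f only while it
    stays in the box.  If k left the box, consider the last time r at which it
    is outside the open box: on [r, T] it is in the closed box, hence coincides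
    with h there, but h r lies in the open box. *)
Lemma approx_solution_unique (R : realType) (n : nat)
    (F f : 'rV[R]_n * R -> 'rV[R]_n) (T M B : R) (h k : R -> 'rV[R]_n) :
  assumption2 T f -> ode_solution f `[0, T] h ->
  (forall t, 0 <= t <= T -> `|h t| < B) ->
  0 < M -> unif_modulus F ->
  (forall x t, `|x| <= B -> 0 <= t <= T -> F (x, t) = f (x, t)) ->
  approx_solution F T M 0 k -> k T = h T ->
  forall t, 0 <= t <= T -> k t = h t.
Proof.
move=> [_ uniq] hf hB M0 uF Ff kF kT.
have kM s t : 0 <= s <= T -> 0 <= t <= T -> `|k s - k t| <= M * `|s - t|.
  by move=> sT tT; have [] := kF s t sT tT; rewrite addr0.
(* As long as k stays in the box backwards from T, it is h. *)
have agree (t0 : R) : 0 <= t0 <= T -> (forall t, t0 <= t <= T -> `|k t| <= B) ->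
    forall t, t0 <= t <= T -> k t = h t.
  move=> /andP[t00 t0T] kB t tI; have /andP[t0t tT] := tI.
  have sub : `[t0, T] `<=` `[0, T].
    by move=> s /=; rewrite !in_itv /= => /andP[t0s ->]; rewrite (le_trans t00).
  apply: (uniq `[t0, T]%classic `[0, T]%classic k h _ _ _ _ _ hf T) => //=.
  - exact: interval_is_interval.
  - apply: (approx_solution_ode M0 uF kF sub) => s sI.
    apply: Ff; last by have := sub _ sI; rewrite /= in_itv.
    by apply: kB; move: sI; rewrite /= in_itv.
  - exact: interval_is_interval.
  - by rewrite in_itv /= t0T lexx.
  - by rewrite in_itv /= (le_trans t00 t0T) lexx.
  - by rewrite in_itv /= (le_trans t00 t0t).
move=> t tT; have /andP[t0 tT'] := tT.
have T0 : 0 <= T := le_trans t0 tT'.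
apply: (agree 0) => //; first by rewrite lexx.
move=> s sT; rewrite leNgt; apply/negP => Bs.
pose A := [set r | 0 <= r <= T /\ B <= `|k r|].
have As : A s by split=> //; exact: ltW.
have supA : has_sup A by split; [exists s|exists T => r [/andP[]]].
pose r := sup A.
have Ar x : A x -> x <= r by apply: sup_upper_bound.
have r0 : 0 <= r by have /andP[s0 _] := sT; exact: le_trans (Ar s As).
have rT : r <= T by apply: ge_sup => [|x [/andP[]]//]; exists s.
have rI : 0 <= r <= T by rewrite r0.
have zT : 0 <= T <= T by rewrite T0 lexx.
(* The set A of outside times is closed, because k is Lipschitz. *)
have Br : B <= `|k r|.
  rewrite leNgt; apply/negP => rB.
  have d0 : 0 < (B - `|k r|) / M by rewrite divr_gt0// subr_gt0.
  have [x [xT Bx] rx] := sup_adherent d0 supA.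
  have xr := Ar x (conj xT Bx).
  have := kM x r xT rI; rewrite distrC (distrC x) (ger0_norm (_ : 0 <= r - x)) ?subr_ge0//.
  have : M * (r - x) < B - `|k r| by rewrite mulrC -ltr_pdivlMr//; rewrite -/r in rx; lra.
  have := lerB_dist (k x) (k r); rewrite distrC; lra.
have rltT : r < T.
  by rewrite lt_neqAle rT andbT; apply/eqP => rE; move: Br; rewrite rE kT leNgt hB.
(* At r itself k is not beyond the boundary of the box: otherwise it would
   still be outside at some time r + d, later than r. *)
have kB x : r <= x <= T -> `|k x| <= B.
  move=> /andP[rx xT]; rewrite leNgt; apply/negP => Bx.
  have xI : 0 <= x <= T by rewrite xT (le_trans r0).
  have xr : x = r by apply/le_anti; rewrite rx Ar//; split => //; exact: ltW.
  subst x; pose d := Num.min (T - r) ((`|k r| - B) / M).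
  have d0 : 0 < d by rewrite lt_min subr_gt0 rltT divr_gt0// subr_gt0.
  have dT : d <= T - r by rewrite ge_min lexx.
  have dB : d <= (`|k r| - B) / M by rewrite ge_min lexx orbT.
  have yI : 0 <= r + d <= T by apply/andP; split; lra.
  have := kM _ _ rI yI; rewrite opprD addrA subrr sub0r normrN (gtr0_norm d0) => kd.
  have : M * d <= `|k r| - B by rewrite mulrC -ler_pdivlMr.
  have := lerB_dist (k r) (k (r + d)) => ? ?.
  have /Ar : A (r + d) by split => //; lra.
  by lra.
have kr := agree r rI kB r.
by move: Br; rewrite kr ?lexx ?rT// leNgt hB.
Qed.

(** Otherwise some solutions k m with k m T -> h T are at distance >= e from h
    at times s m.  Their ultralimit is a solution through h T, so it is h; let
    s be the ultralimit of the times s m.  Then k m (s m) and k m s get close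
    by the common Lipschitz constant, k m s tends to h s, and h (s m) tends to
    h s as well: the distance tends to 0. *)
Lemma approx_solution_stable (R : realType) (n : nat)
    (F f : 'rV[R]_n * R -> 'rV[R]_n) (T M B : R) (h : R -> 'rV[R]_n) :
  0 <= T -> assumption2 T f -> ode_solution f `[0, T] h ->
  (forall t, 0 <= t <= T -> `|h t| < B) ->
  0 < M -> unif_modulus F ->
  (forall x t, `|x| <= B -> 0 <= t <= T -> F (x, t) = f (x, t)) ->
  forall e, 0 < e -> exists2 d, 0 < d & forall k,
    approx_solution F T M 0 k -> `|k T - h T| <= d ->
    forall t, 0 <= t <= T -> `|k t - h t| < e.
Proof.
move=> T0 a2 hf hB M0 uF Ff e e0; apply: contrapT => nd.
have /choice[p pP] : forall m, exists p : (R -> 'rV[R]_n) * R,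
    [/\ approx_solution F T M 0 p.1, `|p.1 T - h T| <= m.+1%:R^-1,
        0 <= p.2 <= T & e <= `|p.1 p.2 - h p.2|].
  move=> m; apply: contrapT => np; apply: nd; exists m.+1%:R^-1 => // k kF kT t tT.
  by rewrite ltNge; apply/negP => ekh; apply: np; exists (k, t).
have [U [UU Uoo]] := nat_ultrafilter.
have PU : ProperFilter U by exact: ultra_proper.
have TI : 0 <= T <= T by rewrite T0 lexx.
have zI : 0 <= (0 : R) <= T by rewrite lexx.
have [|m|m|l [lF kl]] := @approx_solutions_subconverge R n F T M
    (1 + `|h T| + M * T) (fun=> 0) (fun m => (p m).1) U UU (ltW M0) uF (fun=> ler01).
- exact: cvg_cst.
- by have [] := pP m.
- have [kF kT _ _] := pP m; have [+ _] := kF 0 T zI TI.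
  rewrite sub0r normrN (ger0_norm T0) addr0 => kM.
  have : `|(p m).1 T - h T| <= 1.
    by apply: le_trans kT _; rewrite invf_le1// ler1n.
  have := lerB_dist ((p m).1 T) (h T).
  have := lerB_dist ((p m).1 0) ((p m).1 T).
  lra.
have lT : l T = h T.
  apply: (cvg_unique _ (kl T TI)) => //.
  rewrite -[h T]add0r.
  have -> : (fun m => (p m).1 T) = (fun m => (p m).1 T - h T) + (fun=> h T).
    by apply/funext => m; rewrite fctE subrK.
  apply: cvgD; last exact: cvg_cst.
  by apply: cvg0_norm_le (inv_succ_ultra_cvg0 Uoo) => m; have [] := pP m.
have lh := approx_solution_unique a2 hf hB M0 uF Ff lF lT.
have [s sT ps] : exists2 s, `[0, T]%classic s & (p m).2 @[m --> U] --> s.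
  apply: (compact_ultralimit UU (@segment_compact R 0 T)) => m.
  by rewrite /= in_itv; have [] := pP m.
have sI : 0 <= s <= T by move: sT; rewrite /= in_itv.
have hps : h (p m).2 @[m --> U] --> h s.
  apply: (@cvg_comp _ _ _ (fun m => (p m).2) h U (within `[0, T] (nbhs s))).
    move=> A /= sA; rewrite nbhs_filterE /=.
    move: (ps _ sA); rewrite nbhs_filterE /=; apply: filterS => m /=; apply.
    by rewrite in_itv; have [] := pP m.
  by move/ode_solution_within_continuous/subspace_continuousP : hf; apply.
have dps : (p m).1 (p m).2 - (p m).1 s @[m --> U] --> (0 : 'rV[R]_n).
  apply: (@cvg0_norm_le R _ _ U _ (fun m => M * `|(p m).2 - s|)) => [m|].
    have [kF _ tI _] := pP m; have [+ _] := kF _ _ tI sI.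
    by rewrite addr0.
  rewrite -[X in _ --> X](mulr0 M); apply: cvgMr.
  rewrite -[X in _ --> X](normr0 R) -[X in `|X|](subrr s).
  by apply: cvg_norm; apply: cvgB => //; exact: cvg_cst.
have c0 : `|(p m).1 (p m).2 - h (p m).2| @[m --> U] --> (0 : R).
  rewrite -[X in _ --> X](normr0 'rV[R]_n) -[X in `|X|](subrr (h s)).
  apply: cvg_norm; apply: cvgB => //; rewrite -[h s]add0r -lh//.
  have -> : (fun m => (p m).1 (p m).2) =
      (fun m => (p m).1 (p m).2 - (p m).1 s) + (fun m => (p m).1 s).
    by apply/funext => m; rewrite fctE subrK.
  by apply: cvgD => //; exact: kl.
have : e <= 0.
  apply: ler_cvg_to (cvg_cst e) c0 _.
  by apply: nearW => m; have [] := pP m.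
by rewrite leNgt e0.
Qed.

(** * Local inversion of the time-T map *)

(** The box has as half-width a bound of |h| plus 1, so that every curve within distance 1
    of h stays in it. *)
Lemma backward_flow (R : realType) (n : nat) (f : 'rV[R]_n * R -> 'rV[R]_n)
    (T : R) (h : R -> 'rV[R]_n) (e : R) :
  0 <= T -> assumption2 T f -> ode_solution f `[0, T] h -> 0 < e ->
  exists2 d, 0 < d & forall y, `|y - h T| <= d -> exists k,
    [/\ ode_solution f `[0, T] k, k T = y & `|k 0 - h 0| < e].
Proof.
move=> T0 a2 hf e0.
have [C [_ hC]] := compact_bounded
  (continuous_compact (ode_solution_within_continuous hf) (@segment_compact R 0 T)).
pose C' := Num.max 0 (C + 1).
have {}hC t : 0 <= t <= T -> `|h t| <= C'.
  move=> tT; apply: (hC C'); first by rewrite lt_max (ltrDl C) ltr01 orbT.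
  by exists t => //=; rewrite in_itv.
have C0 : 0 <= C' by rewrite le_max lexx.
have hB t : 0 <= t <= T -> `|h t| < C' + 1.
  by move=> /hC /le_lt_trans; apply; rewrite ltrDl.
have [cf _] := a2.
have [F [M [M1 FM uF Ff]]] := truncated_field T0 (addr_ge0 C0 ler01) cf.
have M0 : 0 < M := lt_le_trans ltr01 M1.
have [|d d0 dP] := approx_solution_stable T0 a2 hf hB M0 uF Ff (e := Num.min e 1).
  by rewrite lt_min e0 ltr01.
exists d => // y yd; have [k [kF kT]] := backward_peano y T0 M1 FM uF.
have kh t : 0 <= t <= T -> `|k t - h t| < Num.min e 1.
  by apply: dP => //; rewrite kT.
exists k; split => //; last first.
  by have := kh 0; rewrite lexx T0 => /(_ isT); rewrite lt_min => /andP[].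
apply: (approx_solution_ode M0 uF kF) => // t; rewrite /= in_itv /= => tT.
apply: Ff => //; have := kh t tT; rewrite lt_min => /andP[_ k1].
have := hC t tT; have := lerB_dist (k t) (h t); lra.
Qed.

Lemma NODE1_solution (R : realType) (n : nat) (T : R) (f : 'rV[R]_n * R -> 'rV[R]_n)
    (k : R -> 'rV[R]_n) :
  0 <= T -> assumption2 T f -> ode_solution f `[0, T] k -> NODE1 T f (k 0) = k T.
Proof.
move=> T0 [_ uniq] kf; rewrite /NODE1.
have [nf n0] : ivp_solution T f (k 0) (node_solution T f (k 0)).
  by apply: (@xgetPex _ _ [set h | ivp_solution T f (k 0) h]); exists k.
have T_T : `[0, T]%classic T by rewrite /= in_itv /= T0 lexx.
have T_0 : `[0, T]%classic 0 by rewrite /= in_itv /= T0 lexx.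
by apply: (uniq `[0, T]%classic `[0, T]%classic _ _ _ _ nf _ _ kf 0) => //; exact: interval_is_interval.
Qed.

(** The section is y |-> K y 0, where K y is a solution ending at y.  Its
    continuity at y is [backward_flow] around K y instead of h, since
    uniqueness identifies the solutions found there with those chosen by K. *)
Lemma NODE1_local_section (R : realType) (n : nat) (T : R)
    (f : 'rV[R]_n * R -> 'rV[R]_n) (p : 'rV[R]_n) (e : R) :
  0 <= T -> assumption2 T f -> (exists h, ivp_solution T f p h) -> 0 < e ->
  exists (d : R) (g : 'rV[R]_n -> 'rV[R]_n), [/\ 0 < d,
    {within ball (NODE1 T f p) d, continuous g}, g (NODE1 T f p) = p
    & forall y, ball (NODE1 T f p) d y -> ball p e (g y) /\ NODE1 T f (g y) = y].
Proof.
move=> T0 a2 [h [hf hp]] e0; rewrite -{}hp (NODE1_solution T0 a2 hf).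
have T_T : `[0, T]%classic T by rewrite /= in_itv /= T0 lexx.
have T_0 : `[0, T]%classic 0 by rewrite /= in_itv /= T0 lexx.
have uniq k k' : ode_solution f `[0, T] k -> ode_solution f `[0, T] k' ->
    k T = k' T -> k 0 = k' 0.
  move=> kf k'f kk'; have [_ u] := a2.
  by apply: (u `[0, T]%classic `[0, T]%classic _ _ _ _ kf _ _ k'f T) => //; exact: interval_is_interval.
have [d d0 dP] := backward_flow T0 a2 hf e0.
have /choice[K KP] : forall y, exists k, `|y - h T| <= d ->
    [/\ ode_solution f `[0, T] k, k T = y & `|k 0 - h 0| < e].
  move=> y; have [yd|_] := boolP (`|y - h T| <= d); last by exists h.
  by have [k kP] := dP y yd; exists k.
have Kball y : ball (h T) d y -> [/\ ode_solution f `[0, T] (K y), K y T = y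
    & `|K y 0 - h 0| < e].
  by rewrite -ball_normE /= => yd; apply: KP; rewrite distrC ltW.
exists d, (fun y => K y 0); split => //.
- apply/subspace_continuousP => y yd; apply/cvgrPdist_lt => eps eps0.
  have [yf yT _] := Kball y yd.
  have [r r0 rP] := backward_flow T0 a2 yf eps0.
  apply/nbhs_ballP; exists r => //= z yz zd.
  move: yz; rewrite -ball_normE /= => yz.
  have [zf zT _] := Kball z zd.
  have [|k [kf kT k0]] := rP z; first by rewrite yT distrC ltW.
  rewrite /from_subspace distrC -(uniq _ _ kf zf) ?zT//.
- have [hf' hT _] := Kball (h T) (ballxx _ d0).
  exact: uniq.
- move=> y yd; have [yf yT y0] := Kball y yd; split.
    by rewrite -ball_normE /= distrC.
  by rewrite (NODE1_solution T0 a2 yf).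
Qed.

Theorem theorem2p5 (R : realType) (n : nat) (T : R) (X : set 'rV[R]_n.+1)
    (Phi : 'rV[R]_n.+1 -> 'rV[R]_n.+1) :
  0 < T -> open X -> {within X, continuous Phi} ->
  (exists i : 'I_n.+1,
     top_morse X (fun x => Phi x ord0 i) /\
     exists p, top_critical X (fun x => Phi x ord0 i) p) ->
  ~ embedded_in_NODE1 T X Phi.
Proof.
move=> T0 oX cPhi [i [_ [p [Xp]]]] + [f [[_ sol] a2 PhiE]]; apply.
have [e /= e0 eX] := (@nbhs_ballP R _ p X).1 (open_nbhs_nbhs (conj oX Xp)).
have [d [g [d0 cg gp gP]]] := NODE1_local_section (ltW T0) a2 (sol p Xp) e0.
rewrite -PhiE// in cg gp gP.
have Xg y : ball (Phi p) d y -> X (g y) by move=> /gP[/eX].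
have Phig y : ball (Phi p) d y -> Phi (g y) = y.
  by move=> yd; rewrite PhiE; [have [] := gP y yd|exact: Xg].
(* S exchanges coordinate i, in which Phi is read, with the last coordinate,
   which the definition of an ordinary point singles out. *)
pose S (v : 'rV[R]_n.+1) : 'rV[R]_n.+1 := \row_j v ord0 (tperm i ord_max j).
have S_norm v : `|S v| <= `|v|.
  by apply/rV_norm_le => // j; rewrite mxE; exact: rV_coord_le.
have SK : involutive S by move=> v; apply/rowP => j; rewrite !mxE tpermK.
have SB v w : S v - S w = S (v - w) by apply/rowP => j; rewrite !mxE.
have S_cvg (G : set_system 'rV[R]_n.+1) (u : 'rV[R]_n.+1 -> 'rV[R]_n.+1) l :
    Filter G -> u @ G --> l -> S (u x) @[x --> G] --> S l.
  move=> FG /cvgrPdist_lt ul; apply/cvgrPdist_lt => r r0; move: (ul r r0).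
  by apply: filterS => x; rewrite SB; exact: le_lt_trans.
have c : continuous (fun w : 'rV[R]_n.+1 => Phi p + S w).
  move=> v.
  apply/(@cvgrPdist_lt _ _ _ (nbhs v) (nbhs_filter v)) => r r0.
  apply/nbhs_ballP; exists r => //= w.
  by rewrite -ball_normE /= opprD addrACA subrr add0r SB; exact: le_lt_trans.
have ballS v : ball 0 d v -> ball (Phi p) d (Phi p + S v).
  by rewrite -!ball_normE /= opprD addrA subrr sub0r !sub0r !normrN; exact: le_lt_trans.
have S0 : S 0 = 0 by apply/rowP => j; rewrite !mxE.
exists (ball 0 d), (fun v => g (Phi p + S v)); split.
- exact: nbhsx_ballx.
- split.
    apply/subspace_continuousP => v vd.
    apply: (@cvg_comp _ _ _ (fun v => Phi p + S v) g _
      (within (ball (Phi p) d) (nbhs (Phi p + S v)))).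
      move=> A /= A'; rewrite nbhs_filterE /=.
      rewrite /within /=; move: (c v _ A'); rewrite nbhs_filterE /=.
      apply: (@filterS _ _ (nbhs_filter v)) => w /= + wd; apply.
      exact: ballS.
    by move/subspace_continuousP : cg; apply; exact: ballS.
  exists (fun x => S (Phi x - Phi p)); split; last first.
    by move=> v vd; rewrite Phig; [rewrite addrC addKr SK|exact: ballS].
  have sub : (fun v => g (Phi p + S v)) @` ball 0 d `<=` X.
    by move=> _ [v vd <-]; apply: Xg; exact: ballS.
  apply/subspace_continuousP => x xI; apply: S_cvg.
  apply: cvgB; last exact: cvg_cst.
  by have /subspace_continuousP := continuous_subspaceW sub cPhi; apply.
- by move=> _ [v vd <-]; apply: Xg; exact: ballS.
- by rewrite S0 addr0.
- by move=> v vd; rewrite Phig; [rewrite !mxE tpermL|exact: ballS].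
Qed.
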